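(* Let $\{M(t)\}_{t\ge0}$ be a GCP which performs $k$ kinds of jumps of amplitude $1,\dots,k$ with positive rates $\lambda_1,\dots,\lambda_k$, let $q\ge2$, let $p_1,\dots,p_q\ge0$ with $\sum_{i=1}^{q}p_i=1$, and let $\{M_1(t)\}_{t\ge0},\dots,\{M_q(t)\}_{t\ge0}$ be the Type I split components of $\{M(t)\}_{t\ge0}$ obtained by rolling a $q$-faced die with face probabilities $p_1,\dots,p_q$. Then the split component processes $\{M_i(t)\}_{t\ge0}$, $1\le i\le q$, are independent.
   Context: A counting process is an $\mathbb{N}_0$-valued process with nondecreasing right-continuous paths. A generalized counting process (GCP) performing $k$ kinds of jumps of amplitude $1,2,\dots,k$ with positive rates $\lambda_1,\dots,\lambda_k$ is a counting process $\{M(t)\}_{t\ge0}$ with $M(0)=0$ and independent and stationary increments such that, as $h\to0^+$, $\mathrm{Pr}\{M(t+h)=n+j\mid M(t)=n\}$ equals $1-\sum_{i=1}^k\lambda_i h+o(h)$ for $j=0$, $\lambda_jh+o(h)$ for $1\le j\le k$, and $o(h)$ for $j\ge k+1$. Type I splitting with a $q$-faced die: let $T_1<T_2<\cdots$ be the successive jump times of $\{M(t)\}_{t\ge0}$ and $J_1,J_2,\dots\in\{1,\dots,k\}$ the corresponding jump sizes. At each jump time $T_n$ the die is rolled once, giving outcome $\xi_n\in\{1,\dots,q\}$, where $\xi_1,\xi_2,\dots$ are i.i.d. with $\mathrm{Pr}\{\xi_n=i\}=p_i$ and independent of $\{M(t)\}_{t\ge0}$. The whole jump $J_n$ is registered in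 component $\xi_n$: $M_i(t)=\sum_{n:\,T_n\le t}J_n\mathbf{1}\{\xi_n=i\}$, $1\le i\le q$. *)

(* Defs.v *)
From HB Require Import structures.
From mathcomp Require Import all_boot all_order all_algebra finmap.
From mathcomp Require Import all_classical all_reals all_analysis.

Set Implicit Arguments.
Unset Strict Implicit.
Unset Printing Implicit Defensive.

Import Order.TTheory GRing.Theory Num.Theory.
Import numFieldNormedType.Exports.

Local Open Scope classical_set_scope.
Local Open Scope ring_scope.

Definition mutual_independence (d : measure_display) (T : measurableType d)
    (R : realType) (P : probability T R) (I : choiceType)
    (F : I -> set (set T)) : Prop :=
  (forall i, F i `<=` measurable) /\
  (forall (J : {fset I}) (E : I -> set T), (forall j, j \in J -> F j (E j)) ->
    P (\bigcap_(j in [set` J]) E j) = (\prod_(j <- J) P (E j))%E).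

(* Every state space below (nat, 'I_q) is countable and discrete, so each
   subset B of S counts as measurable in the next two definitions. *)
Definition sigma_rv (T S : Type) (X : T -> S) : set (set T) :=
  preimage_set_system setT X [set: set S].

Definition sigma_process (T S I : Type) (D : set I) (X : I -> T -> S) :
    set (set T) :=
  <<s \bigcup_(t in D) sigma_rv (X t) >>.

Section Processes.
Context (d : measure_display) (T : measurableType d) (R : realType).
Variable P : probability T R.

Definition cond_prob (A B : set T) : R := fine (P (A `&` B)) / fine (P B).

(* The index set is R; only the times t >= 0 are ever used. *)
Definition times : set R := [set t | 0 <= t].

Record counting_process (M : R -> {RV P >-> nat}) : Prop := {
  counting_nondecreasing : forall (w : T) (s t : R),
    0 <= s -> s <= t -> (M s w <= M t w)%N ;
  counting_right_continuous : forall (w : T) (t : R),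
    0 <= t -> (fun s => M s w) @ t^'+ --> M t w }.

(* The subtraction of nat is exact here since paths are nondecreasing. *)
Definition increment (M : R -> {RV P >-> nat}) (s t : R) (w : T) : nat :=
  (M t w - M s w)%N.

(* [lambda j] is the rate of the jumps of amplitude j, for 1 <= j <= k; the
   other values of lambda are irrelevant. *)
Record generalized_counting_process (k : nat) (lambda : nat -> R)
    (M : R -> {RV P >-> nat}) : Prop := {
  gcp_counting : counting_process M ;
  gcp_start : forall w, M 0 w = 0%N ;
  gcp_independent_increments : forall (n : nat) (t : nat -> R),
    0 <= t 0%N -> (forall l, (l < n)%N -> t l <= t l.+1) ->
    mutual_independence P
      (fun l : 'I_n => sigma_rv (increment M (t l) (t l.+1))) ;
  gcp_stationary_increments : forall (s t h : R) (B : set nat),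
    0 <= s -> 0 <= t -> 0 <= h ->
    P (increment M s (s + h) @^-1` B) = P (increment M t (t + h) @^-1` B) ;
  gcp_no_jump : forall (t : R) (n : nat),
    0 <= t -> P (M t @^-1` [set n]) != 0%E ->
    (fun h : R => cond_prob (M (t + h) @^-1` [set n]) (M t @^-1` [set n])
      - (1 - (\sum_(1 <= i < k.+1) lambda i) * h))
    =o_ (0^'+) (fun h : R => h) ;
  gcp_jump : forall (t : R) (n j : nat),
    0 <= t -> P (M t @^-1` [set n]) != 0%E -> (1 <= j <= k)%N ->
    (fun h : R =>
       cond_prob (M (t + h) @^-1` [set (n + j)%N]) (M t @^-1` [set n])
      - lambda j * h)
    =o_ (0^'+) (fun h : R => h) ;
  gcp_large_jump : forall (t : R) (n j : nat),
    0 <= t -> P (M t @^-1` [set n]) != 0%E -> (k < j)%N ->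
    (fun h : R =>
       cond_prob (M (t + h) @^-1` [set (n + j)%N]) (M t @^-1` [set n]))
    =o_ (0^'+) (fun h : R => h) }.

(* T_0 = 0 and T_(n+1) = inf {t > T_n | m t <> m T_n}, which is +oo if the
   path m has at most n jumps. *)
Fixpoint jump_time (m : R -> nat) (n : nat) : \bar R :=
  if n is n'.+1 then
    ereal_inf [set t%:E | t in [set t : R |
      (jump_time m n' < t%:E)%E /\ m t <> m (fine (jump_time m n'))]]
  else 0%E.

(* J_n, for n >= 1 with T_n finite. *)
Definition jump_size (m : R -> nat) (n : nat) : nat :=
  (m (fine (jump_time m n)) - m (fine (jump_time m n.-1)))%N.

(* [xi n] is the roll made at the jump time T_(n+1): rolls are numbered from
   0, jumps from 1. *)
Record die_rolls (q : nat) (p : 'I_q -> R) (M : R -> {RV P >-> nat})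
    (xi : nat -> T -> 'I_q) : Prop := {
  rolls_independent : mutual_independence P (fun n => sigma_rv (xi n)) ;
  rolls_law : forall n i, P (xi n @^-1` [set i]) = (p i)%:E ;
  rolls_independent_of_process : forall A B : set T,
    sigma_process [set: nat] xi A -> sigma_process times M B ->
    P (A `&` B) = (P A * P B)%E }.

(* For a counting process the index set is finite: T_1 < T_2 < ... and each
   finite T_n contributes at least 1 to the path. *)
Definition split_component (q : nat) (M : R -> {RV P >-> nat})
    (xi : nat -> T -> 'I_q) (i : 'I_q) (t : R) (w : T) : nat :=
  \big[addn/0%N]_(n \in [set n | (jump_time (M ^~ w) n.+1 <= t%:E)%E])
    (jump_size (M ^~ w) n.+1 * (xi n w == i))%N.

End Processes.

(* Main.v *)
Require Import Defs.
From HB Require Import structures.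
From mathcomp Require Import all_boot all_order all_algebra finmap.
From mathcomp Require Import all_classical all_reals all_analysis.
From mathcomp Require Import ring lra zify.
Import Order.TTheory GRing.Theory Num.Theory.
Import numFieldNormedType.Exports.
Local Open Scope classical_set_scope.
Local Open Scope ring_scope.
Set Implicit Arguments.
Unset Strict Implicit.
Unset Printing Implicit Defensive.

(* Cut [0, oo[ into cells of length h. If no cell contains two jumps, then each
   component is obtained by attaching the next roll to every nonzero increment
   of M over a cell. The pairs (increment, roll) are i.i.d., so the vectors of
   component increments are i.i.d. over the cells; at most one coordinate of
   such a vector is nonzero, with probability a = O(h), hence its law is within
   a^2 of the product of its marginals. Over O(1/h) cells the components are
   thus independent up to O(h). A path has finitely many jumps on bounded
   intervals, so for every outcome the discretized components are eventually
   equal to the true ones, and h -> 0 gives independence of the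
   finite-dimensional cylinders; a pi-lambda argument concludes. Increments are
   capped at a large m, which keeps all the sums finite. *)

(** * Thinning of finite sequences *)

Lemma big_tuple_cons (R : Type) (idx : R) (op : Monoid.com_law idx)
    (V : finType) (n : nat) (F : seq V -> R) :
  \big[op/idx]_(s : n.+1.-tuple V) F s =
  \big[op/idx]_(v : V) \big[op/idx]_(s : n.-tuple V) F (v :: s).
Proof.
rewrite pair_big/=.
rewrite (reindex (fun x : V * n.-tuple V => cons_tuple x.1 x.2)) //=.
exists (fun s : n.+1.-tuple V => (thead s, [tuple of behead s])).
  by move=> [v s] _ /=; congr pair; apply: val_inj.
by move=> s _; apply: val_inj => /=; rewrite [in RHS](tuple_eta s).
Qed.

Lemma big_tuple0 (R : Type) (idx : R) (op : Monoid.law idx)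
    (V : finType) (F : seq V -> R) :
  \big[op/idx]_(s : 0.-tuple V) F s = F [::].
Proof.
rewrite (big_pred1 [tuple]) //= => s; rewrite [s]tuple0; exact/esym/eqP.
Qed.

Section Thinning.
Context (q : nat).

(* The successive marks are consumed by the nonzero increments only. *)
Fixpoint thin (ds : seq nat) (es : seq 'I_q) (i : 'I_q) : seq nat :=
  match ds, es with
  | d :: ds', e :: es' =>
    if d == 0%N then 0%N :: thin ds' es i
    else (if e == i then d else 0%N) :: thin ds' es' i
  | _, _ => [::]
  end.

Definition cell (y : nat * 'I_q) (X : 'I_q -> seq nat) : 'I_q -> seq nat :=
  fun j => (if y.2 == j then y.1 else 0)%N :: X j.

(** A map that vanishes exactly at 0 does not change which entries consume a mark. It serves to move
    the cap [minn^~ m], with m positive, out of the thinning. *)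
Lemma map_thin (g : nat -> nat) (ds : seq nat) (es : seq 'I_q) (i : 'I_q) :
  (forall n, (g n == 0%N) = (n == 0%N)) ->
  thin (map g ds) es i = map g (thin ds es i).
Proof.
move=> g0; have g00 : g 0%N = 0%N by apply/eqP; rewrite g0.
elim: ds es => [|d ds IH] [|e es] //=.
by rewrite g0; case: (d == 0%N) => /=; rewrite IH ?g00 //; case: (e == i); rewrite ?g00.
Qed.

(** Since only nonzero entries consume marks, the mark met at position [l] is numbered by the
    nonzero entries before it. With [L <= L'] the marks cannot run out. *)
Lemma sumn_take_thin (D : nat -> nat) (xi : nat -> 'I_q) (n L L' : nat)
    (i : 'I_q) : (n <= L)%N -> (L <= L')%N ->
  sumn (take n (thin (mkseq D L) (mkseq xi L') i)) =
  (\sum_(l < n) D l * (xi (\sum_(l' < l) (D l' != 0%N)) == i))%N.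
Proof.
elim: n D xi L L' => [|n IH] D xi [|L] [|L'] //= nL LL'; rewrite ?take0 ?big_ord0 //.
rewrite big_ord_recl big_ord0.
have mkS (A : Type) (f : nat -> A) k : [seq f j | j <- iota 1 k] = mkseq (f \o succn) k.
  by rewrite (iotaDl 1 0) -map_comp.
rewrite (mkS _ D); case: eqP => D0 /=.
  rewrite IH ?(ltnW LL')//.
  rewrite D0 mul0n; congr addn; apply: eq_bigr => l _ /=.
  by rewrite big_ord_recl D0 /= add0n.
rewrite mkS IH//; congr addn; first by case: eqP; rewrite ?muln1 ?muln0.
apply: eq_bigr => l _ /=; rewrite big_ord_recl /=.
by move/eqP: D0 => ->.
Qed.

(** * Expectations over i.i.d. cells *)

Context (R : realFieldType) (m : nat) (r : 'I_m.+1 -> R) (p : 'I_q -> R).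
Hypothesis r_ge0 : forall v, 0 <= r v.
Hypothesis p_ge0 : forall i, 0 <= p i.
Hypothesis sum_r : \sum_v r v = 1.
Hypothesis sum_p : \sum_i p i = 1.

Let w (y : 'I_m.+1 * 'I_q) : R := r y.1 * p y.2.

(* The expectation of [F] over [L] i.i.d. cells: a mark is drawn in every cell,
   including those with increment [0], where it has no effect. *)
Fixpoint cells_mean (L : nat) (F : ('I_q -> seq nat) -> R) : R :=
  if L is L'.+1 then
    \sum_y w y * cells_mean L' (fun X => F (cell (nat_of_ord y.1, y.2) X))
  else F (fun=> [::]).

Lemma tuple_sum1 L' : \sum_(e : L'.-tuple 'I_q) \prod_(i <- e) p i = 1.
Proof.
elim: L' => [|n IH].
  by rewrite (big_tuple0 _ (fun e => \prod_(i <- e) p i)) big_nil.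
rewrite (big_tuple_cons _ _ (fun e => \prod_(i <- e) p i)) -[RHS]sum_p.
apply: eq_bigr => i _; under eq_bigr do rewrite big_cons.
by rewrite -mulr_sumr IH mulr1.
Qed.

(** The marks are i.i.d., so a zero entry may be given a fresh mark of its own: it has no effect and
    its weights sum to one. The slack [L <= L'] is needed by the induction, because a zero entry
    shortens the increments but not the marks. *)
Lemma thin_mean L L' (F : ('I_q -> seq nat) -> R) : (L <= L')%N ->
  \sum_(s : L.-tuple 'I_m.+1) \sum_(e : L'.-tuple 'I_q)
     (\prod_(v <- s) r v) * (\prod_(i <- e) p i) * F (thin (map (@nat_of_ord m.+1) s) e) =
  cells_mean L F.
Proof.
elim: L L' F => [|L IH] L' F LL'.
  rewrite (big_tuple0 _ (fun s : seq 'I_m.+1 => \sum_(e : L'.-tuple 'I_q)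
     (\prod_(v <- s) r v) * (\prod_(i <- e) p i) * F (thin (map (@nat_of_ord m.+1) s) e)))/=.
  under eq_bigr do rewrite big_nil mul1r; rewrite -mulr_suml tuple_sum1 mul1r.
  by congr F; apply/funext => i.
case: L' LL' => // L' LL'.
rewrite (big_tuple_cons _ _ (fun s : seq 'I_m.+1 => \sum_(e : L'.+1.-tuple 'I_q)
     (\prod_(v <- s) r v) * (\prod_(i <- e) p i) * F (thin (map (@nat_of_ord m.+1) s) e)))/=.
rewrite -(pair_bigA _ (fun v i => w (v, i) * cells_mean L (fun X => F (cell (nat_of_ord v, i) X))))/=.
apply: eq_bigr => v _.
(* Zero increment: the fresh mark is integrated out and all [L'.+1] marks remain for the induction
   hypothesis. *)
have [v0|v0] := eqVneq (v : nat) 0%N.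
  transitivity (r v * cells_mean L (fun X => F (fun j => 0%N :: X j))); last first.
    rewrite -[LHS]mulr1 -sum_p mulr_sumr; apply: eq_bigr => i _.
    rewrite /w/= mulrAC; congr (_ * cells_mean _ _).
    apply/funext => X; congr F; apply/funext => j; rewrite /cell/=. by rewrite v0; case: ifP.
  rewrite -(IH L'.+1) 1?ltnW// mulr_sumr; apply: eq_bigr => s _.
  rewrite mulr_sumr; apply: eq_bigr => e _; rewrite big_cons -!mulrA.
  do 3 congr *%R; congr F; apply/funext => j.
  by case: e => -[].
(* Nonzero increment: the first step of [thin] is unfolded, so that the first mark can be split off
   from the tuple. *)
pose G (e : seq 'I_q) := \sum_(s : L.-tuple 'I_m.+1)
  (\prod_(u <- v :: s) r u) * (\prod_(i <- e) p i) *
  F (fun j => if e is i :: e'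
              then (if i == j then nat_of_ord v else 0%N) ::
                   thin (map (@nat_of_ord m.+1) s) e' j
              else [::]).
rewrite exchange_big (eq_bigr (fun e : L'.+1.-tuple 'I_q => G e)); last by [].
rewrite big_tuple_cons /G.
apply: eq_bigr => i _; rewrite -(IH L')// exchange_big/= mulr_sumr.
apply: eq_bigr => s _; rewrite mulr_sumr; apply: eq_bigr => e _.
rewrite !big_cons /w/= !mulrA; congr (_ * _); first by ring.
Qed.

Lemma cells_mean_ge0 L F : (forall X, 0 <= F X) -> 0 <= cells_mean L F.
Proof.
elim: L F => [|L IH] F F0 //=; apply: sumr_ge0 => y _.
by rewrite mulr_ge0 ?mulr_ge0// IH.
Qed.

Lemma sum_w : \sum_y w y = 1.
Proof.
rewrite -(pair_bigA _ (fun v i => r v * p i))/= -[RHS]sum_r.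
by apply: eq_bigr => v _; rewrite -mulr_sumr sum_p mulr1.
Qed.

Lemma cells_mean_le1 L F : (forall X, F X <= 1) -> cells_mean L F <= 1.
Proof.
elim: L F => [|L IH] F F1 //=; rewrite -[leRHS]sum_w; apply: ler_sum => y _.
by rewrite ler_piMr ?mulr_ge0// IH.
Qed.

Let w_ge0 y : 0 <= w y. Proof. exact: mulr_ge0. Qed.

(** The probability that a cell has a nonzero increment. *)
Let a := 1 - r ord0.

Let a_ge0 : 0 <= a.
Proof. by rewrite subr_ge0 -sum_r (bigD1 ord0)//= lerDl sumr_ge0. Qed.

(** Points outside [A] cancel against [g0], and on [A] the deviation is at most 1. *)
Lemma mean_dev (I : finType) (u g : I -> R) (g0 : R) (A : pred I) :
  (forall y, 0 <= u y) -> \sum_y u y = 1 -> 0 <= g0 <= 1 ->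
  (forall y, 0 <= g y <= 1) -> (forall y, ~~ A y -> g y = g0) ->
  `|\sum_y u y * g y - g0| <= \sum_(y | A y) u y.
Proof.
move=> u0 u1 g01 g1 gA.
rewrite -[X in _ - X]mul1r -u1 mulr_suml -sumrB (bigID A)/= [X in _ + X]big1 ?addr0; last first.
  by move=> y Ay; rewrite gA// subrr.
apply: (le_trans (ler_norm_sum _ _ _)); apply: ler_sum => y _.
rewrite -mulrBr normrM ger0_norm// ler_piMr// ler_norml.
by have := g1 y; lra.
Qed.

Let val_cell (g : 'I_q -> nat -> R) (y : 'I_m.+1 * 'I_q) j : R :=
  g j (if y.2 == j then nat_of_ord y.1 else 0)%N.

Lemma sum_w_nz (j : 'I_q) : \sum_(y | (y.2 == j) && (y.1 != ord0)) w y = p j * a.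
Proof.
rewrite -(pair_big_dep xpredT (fun v i => (i == j) && (v != ord0)) (fun v i => r v * p i))/=.
rewrite /a -sum_r (bigD1 ord0)//= [in RHS](bigD1 ord0)//=.
rewrite big_pred0 ?add0r; last by move=> i; rewrite andbF.
rewrite addrC addrK mulr_sumr; apply: eq_bigr => v v0.
by rewrite (big_pred1 j) 1?mulrC// => i; rewrite v0 andbT.
Qed.

(* At most one coordinate of a cell is nonzero, so if A and H depend on
   disjoint sets of coordinates and take the values A0 and H0 on the zero cell,
   then E(AH) - E(A)E(H) = -(E(A) - A0)(E(H) - H0). *)
Lemma one_cell_seq (g : 'I_q -> nat -> R) (s : seq 'I_q) :
  (forall j n, 0 <= g j n <= 1) -> uniq s ->
  `| \sum_y w y * (\prod_(j <- s) val_cell g y j) -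
     \prod_(j <- s) \sum_y w y * val_cell g y j | <= (\sum_(j <- s) p j) * a ^+ 2.
Proof.
move=> g01; elim: s => [|j s IH] /=.
  move=> _; rewrite !big_nil mul0r.
  by under eq_bigr do rewrite big_nil mulr1; rewrite sum_w subrr normr0.
move=> /andP[js us].
set H := fun y => \prod_(j <- s) val_cell g y j.
have H01 (h : 'I_q -> R) : (forall j, 0 <= h j <= 1) -> 0 <= \prod_(j <- s) h j <= 1.
  move=> h01; rewrite prodr_ge0 ?prodr_ile1// => k _; by have /andP[] := h01 k.
pose h0 := \prod_(j <- s) g j 0%N.
pose g0 := g j 0%N.
set B := \prod_(j <- s) \sum_y w y * val_cell g y j.
set EA := \sum_y w y * val_cell g y j.
set EH := \sum_y w y * H y.
have covE : \sum_y w y * (\prod_(k <- j :: s) val_cell g y k) - EA * EH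
    = - ((EA - g0) * (EH - h0)).
  have -> : \sum_y w y * (\prod_(k <- j :: s) val_cell g y k) =
     EA * h0 + g0 * EH - g0 * h0.
    rewrite -[X in _ = _ - X]mul1r -[X in _ - X * _]sum_w !(mulr_suml, mulr_sumr) -big_split/= -sumrB.
    apply: eq_bigr => y _; rewrite big_cons -/(H y).
    (* If the mark is not [j], the first factor vanishes; if it is [j], all coordinates in [s] are
       zero because [j] is not in [s], and the second factor vanishes. *)
    suff e : (val_cell g y j - g0) * (H y - h0) = 0.
      transitivity (w y * (val_cell g y j * h0 + g0 * H y - g0 * h0 +
                    (val_cell g y j - g0) * (H y - h0))); first by ring.
      by rewrite e; ring.
    rewrite /val_cell /g0; case: eqP => yj; last by rewrite subrr mul0r.
    suff -> : H y = h0 by rewrite subrr mulr0.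
    apply: eq_big_seq => k ks; rewrite /val_cell yj; case: eqP => // jk.
    by rewrite jk ks in js.
  ring.
rewrite !big_cons -/B -/EA mulrDl.
have EA01 : 0 <= EA <= 1.
  rewrite /EA sumr_ge0/=; last by move=> y _; rewrite mulr_ge0//; have /andP[] := g01 j (if y.2 == j then nat_of_ord y.1 else 0)%N.
  rewrite -[leRHS]sum_w ler_sum// => y _; rewrite ler_piMr//.
  by have /andP[] := g01 j (if y.2 == j then nat_of_ord y.1 else 0)%N.
(* The first term is at most [p j * a] times [a]: coordinate [j] deviates only under mark [j] with a
   nonzero increment, [H] only under a nonzero increment. The second term is left to the induction
   hypothesis, as [EA] lies in [0, 1]. *)
have -> : \sum_y w y * (\prod_(k <- j :: s) val_cell g y k) - EA * B
   = - ((EA - g0) * (EH - h0)) + EA * (EH - B) by rewrite -covE; ring.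
apply: (le_trans (ler_normD _ _)); apply: lerD.
  rewrite normrN normrM expr2 mulrA; apply: ler_pM => //.
    rewrite -sum_w_nz; apply: mean_dev;
      [exact: w_ge0|exact: sum_w|exact: g01|by move=> y; exact: g01|].
    move=> y; rewrite /val_cell /g0; case: (y.2 == j) => //=.
    by rewrite negbK => /eqP ->.
  have -> : a = \sum_(y | y.1 != ord0) w y.
    rewrite -[LHS]mul1r -sum_p mulr_suml; under eq_bigr do rewrite -sum_w_nz.
    rewrite (exchange_big_dep (fun y => y.1 != ord0))/=; last by move=> ? ? _ /andP[].
    apply: eq_bigr => y y0; rewrite (big_pred1 y.2)// => i.
    by rewrite y0 andbT eq_sym.
  apply: mean_dev; [exact: w_ge0|exact: sum_w| | |].
  - by apply: H01 => k; exact: g01.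
  - by move=> y; apply: H01 => k; exact: g01.
  - move=> y; rewrite negbK => /eqP y0; apply: eq_bigr => k _.
    by rewrite /val_cell y0; case: ifP.
rewrite normrM (ger0_norm (proj1 (andP EA01))).
apply: le_trans (IH us); rewrite ler_piMl//; by have /andP[] := EA01.
Qed.

(** Cells are decoupled one at a time, each at a cost of at most [a ^+ 2]. *)
Lemma cells_mean_prod (L : nat) (f : 'I_q -> seq nat -> R) :
  (forall j s, 0 <= f j s <= 1) ->
  `| cells_mean L (fun X => \prod_j f j (X j)) -
     \prod_j cells_mean L (fun X => f j (X j)) | <= L%:R * a ^+ 2.
Proof.
elim: L f => [|L IH] f f01 /=; first by rewrite mul0r subrr normr0.
(* The conditional mean of [f j] given that its first entry is [n]. *)
pose g j n := cells_mean L (fun X => f j (n :: X j)).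
have g01 j n : 0 <= g j n <= 1.
  by rewrite cells_mean_ge0 ?cells_mean_le1// => X; have /andP[] := f01 j (n :: X j).
have := one_cell_seq g01 (index_enum_uniq 'I_q).
rewrite sum_p mul1r => cellE.
rewrite -natr1 mulrDl mul1r.
(* The intermediate term averages, over the first cell, the product of the conditional means: it is
   compared with the joint mean by induction and with the product of means by [one_cell_seq]. *)
rewrite -(subrKA (\sum_y w y * (\prod_j val_cell g y j))).
apply: (le_trans (ler_normD _ _)); apply: lerD => //.
rewrite -sumrB; apply: (le_trans (ler_norm_sum _ _ _)).
rewrite -[leRHS]mul1r -[X in _ <= X * _]sum_w mulr_suml; apply: ler_sum => y _.
rewrite -mulrBr normrM ger0_norm// ler_wpM2l//.
exact: (IH (fun j s => f j ((if y.2 == j then nat_of_ord y.1 else 0)%N :: s))).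
Qed.

End Thinning.

(** * Jump times of a path *)

Section Path.
Context (R : realType) (m : R -> nat).
Hypothesis m_nd : forall s t : R, 0 <= s -> s <= t -> (m s <= m t)%N.
Hypothesis m_rc : forall t : R, 0 <= t -> (fun s => m s) @ t^'+ --> m t.

Let T := jump_time m.

(** As [nat] is discrete, convergence from the right is eventual equality. *)
Lemma locally_constant_right (t : R) : 0 <= t ->
  exists2 e : R, 0 < e & forall s, t <= s -> s < t + e -> m s = m t.
Proof.
move=> /m_rc mt.
have /mt : nbhs (m t) [set m t] by exact: discrete_set1.
rewrite /= nbhs_filterE => -[e /= e0 He]; exists e => // s ts se.
move: ts; rewrite le_eqVlt => /orP[/eqP->//|ts]; apply: (He s) => //=.
by rewrite /ball/= distrC ger0_norm ?subr_ge0 ?ltW// ltrBlDl.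
Qed.

(** Right continuity is used twice: at [tau] it keeps the infimum away from [tau], and at the
    infimum it shows that the path has already changed there, since times of changed value lie
    arbitrarily close to its right. *)
Lemma jump_time_step n (tau : R) : T n = tau%:E -> 0 <= tau ->
  (T n.+1 = +oo%E /\ forall t, tau <= t -> m t = m tau) \/
  exists sigma : R, [/\ T n.+1 = sigma%:E, tau < sigma, (m tau < m sigma)%N &
    forall t, tau <= t -> t < sigma -> m t = m tau].
Proof.
move=> Tn tau0; pose S := [set t : R | tau < t /\ m t <> m tau].
have TS : T n.+1 = ereal_inf (EFin @` S).
  by rewrite /T/= -/T Tn/=; congr (ereal_inf (image _ _)).
have [S0|/set0P SN0] := eqVneq S set0.
  left; split; first by rewrite TS S0 image_set0 ereal_inf0.
  move=> t; rewrite le_eqVlt => /orP[/eqP->//|tt].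
  by apply: contrapT => mt; have : S t by []; rewrite S0.
have [e e0 He] := locally_constant_right tau0.
have lbS : lbound S (tau + e).
  move=> s [taus ms]; rewrite leNgt; apply/negP => se; apply: ms.
  by apply: He => //; exact: ltW.
have hS : has_inf S by split => //; exists (tau + e).
have taue : tau + e <= inf S by exact: lb_le_inf.
right; exists (inf S).
have cst t : tau <= t -> t < inf S -> m t = m tau.
  rewrite le_eqVlt => /orP[/eqP->//|taut] tS; apply: contrapT => mt.
  by move: tS; rewrite ltNge => /negP; apply; apply: ge_inf => //; exists (tau + e).
have taul : tau < inf S by apply: lt_le_trans taue; rewrite ltrDl.
have iS0 : 0 <= inf S by rewrite (le_trans tau0)// ltW.
split => //; first by rewrite TS ereal_inf_EFin//; exists (tau + e).
have [e' e'0 He'] := locally_constant_right iS0.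
have [s Ss sS] := inf_adherent e'0 hS.
have sge : inf S <= s by apply: ge_inf => //; exists (tau + e).
rewrite ltn_neqAle m_nd// ?ltW// andbT eq_sym -(He' s)//; apply/eqP.
by case: Ss.
Qed.

(** Every jump raises the path by at least one; the bound [n <= m tau] will exclude infinitely many
    jumps in bounded time. *)
Lemma jump_time_fin n : T n = +oo%E \/
  exists tau : R, [/\ T n = tau%:E, 0 <= tau & (n <= m tau)%N].
Proof.
elim: n => [|n [IH|[tau [Tn tau0 nm]]]]; first by right; exists 0.
  (* No real time exceeds an infinite [T n], so the next infimum runs over the empty set. *)
  left; rewrite /T/= -/T IH.
  rewrite (_ : [set t : R | _] = set0) ?image_set0 ?ereal_inf0//.
  by apply/seteqP; split=> t //= -[].
have [[]|] := jump_time_step Tn tau0; first by left.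
move=> [sigma [TS ts ms _]]; right; exists sigma; split => //.
  by rewrite (le_trans tau0)// ltW.
exact: leq_ltn_trans ms.
Qed.

Lemma jump_time_lt n : (T n < +oo)%E -> (T n < T n.+1)%E.
Proof.
have [->|[tau [Tn tau0 _]] _] := jump_time_fin n; first by rewrite ltxx.
have [[-> _]|[s [-> ts _ _]]] := jump_time_step Tn tau0; rewrite Tn.
  exact: ltry.
by rewrite lte_fin.
Qed.

Lemma jump_time_nd : {homo T : n k / (n <= k)%N >-> (n <= k)%E}.
Proof.
apply: homo_leq => [//|y x z|n]; first exact: le_trans.
have [Tn|[tau [Tn _ _]]] := jump_time_fin n; last first.
  by apply/ltW/jump_time_lt; rewrite Tn ltry.
have [->|[tau [TSn tau0 _]]] := jump_time_fin n.+1; first by rewrite leey.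
exfalso; move: TSn; rewrite /T/= -/T Tn.
rewrite (_ : [set t : R | _] = set0) ?image_set0 ?ereal_inf0//.
by apply/seteqP; split=> t //= -[].
Qed.

Definition jump_count (t : R) (n : nat) := (T n <= t%:E)%E && (t%:E < T n.+1)%E.

(** At most [m t] jumps occur up to time [t], so there is a last one. *)
Lemma jump_count_ex (t : R) : 0 <= t -> exists c, jump_count t c.
Proof.
move=> t0.
have bd n : (T n <= t%:E)%E -> (n <= m t)%N.
  have [->|[tau [-> tau0 nm]]] := jump_time_fin n; first by rewrite leye_eq.
  by rewrite lee_fin => /(m_nd tau0); exact: leq_trans.
have ex : exists n, (T n <= t%:E)%E by exists 0%N; rewrite /T/= lee_fin.
case: (ex_maxnP ex bd) => c Tc cmax; exists c; rewrite /jump_count Tc/= ltNge.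
by apply/negP => /cmax; rewrite ltnn.
Qed.

Lemma jump_count_le (t : R) c n : jump_count t c ->
  (T n <= t%:E)%E = (n <= c)%N.
Proof.
move=> /andP[Tc tT]; apply/idP/idP; last first.
  by move=> /jump_time_nd nc; exact: le_trans Tc.
rewrite leqNgt; move=> nt; apply/negP => /jump_time_nd cn.
by have := lt_le_trans tT (le_trans cn nt); rewrite ltxx.
Qed.

Lemma jump_count_uniq (t : R) c c' : jump_count t c -> jump_count t c' -> c = c'.
Proof.
move=> h h'; apply/eqP; rewrite eqn_leq -(jump_count_le _ h) -(jump_count_le _ h').
by case/andP: h => -> _; case/andP: h' => -> _.
Qed.

Lemma jump_count_val (t : R) c : jump_count t c -> m t = m (fine (T c)).
Proof.
move=> /andP[]; have [->|[tau [Tc tau0 _]]] := jump_time_fin c.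
  by rewrite leye_eq.
rewrite Tc lee_fin => taut.
have [[_ cst _]|[s [-> _ _ cst]]] := jump_time_step Tc tau0; first exact: cst.
by rewrite lte_fin; exact: cst.
Qed.

Lemma jump_size_gt0 (t : R) c : jump_count t c.+1 -> (0 < jump_size m c.+1)%N.
Proof.
move=> /andP[]; rewrite (_ : jump_size m c.+1 = m (fine (T c.+1)) - m (fine (T c)))%N//.
have [Tc|[tau [Tc tau0 _]]] := jump_time_fin c.
  have := jump_time_nd (leqnSn c); rewrite Tc leye_eq => /eqP ->.
  by rewrite leye_eq.
have [[-> _]|[s [TS _ ms cst]] _ _] := jump_time_step Tc tau0.
  by rewrite leye_eq.
by rewrite TS Tc/= subn_gt0.
Qed.

Lemma fsbig_jumps (t : R) c (F : nat -> nat) : jump_count t c ->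
  \big[addn/0%N]_(n \in [set n | (T n.+1 <= t%:E)%E]) F n = (\sum_(n < c) F n)%N.
Proof.
move=> tc; rewrite fsbig_ord; congr (\big[addn/0%N]_(n \in _) F n).
by apply/seteqP; split=> n /=; rewrite (jump_count_le _ tc).
Qed.

Lemma jump_gap c : (T c < +oo)%E -> exists2 e : R, 0 < e &
  forall n, (n < c)%N -> (T n + e%:E <= T n.+1)%E.
Proof.
elim: c => [|c IH] Tc; first by exists 1.
have Tc' : (T c < +oo)%E by apply: le_lt_trans Tc; exact: jump_time_nd.
have [e e0 He] := IH Tc'.
have [Ti|[tau [Tt _ _]]] := jump_time_fin c; first by rewrite Ti in Tc'.
have [Ti|[s [Ts _ _]]] := jump_time_fin c.+1; first by rewrite Ti in Tc.
have := jump_time_lt Tc'; rewrite Tt Ts lte_fin => ts.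
exists (Num.min e (s - tau)); first by rewrite lt_min e0 subr_gt0.
move=> n; rewrite ltnS leq_eqVlt => /orP[/eqP ->|nc].
  rewrite Tt Ts -EFinD lee_fin -lerBrDl; by rewrite ge_min lexx orbT.
apply: le_trans (He _ nc); apply: leeD => //; rewrite lee_fin; by rewrite ge_min lexx.
Qed.

(** Only finitely many jumps precede [K]; a window shorter than their least gap contains at most
    one. *)
Lemma jump_count_step (K : R) : 0 <= K -> exists2 e : R, 0 < e &
  forall s s' n, s <= s' -> s' <= K -> s' - s < e ->
  jump_count s n -> jump_count s' n \/ jump_count s' n.+1.
Proof.
move=> /jump_count_ex[c Kc].
have [|e e0 He] := @jump_gap c.
  by case/andP: Kc => h _; apply: le_lt_trans h _; exact: ltry.
exists e => // s s' n ss' s'K sse sn.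
have Tn : (T n <= s'%:E)%E by case/andP: sn => h _; apply: le_trans h _.
have [s'T|Ts'] := ltP s'%:E (T n.+1); first by left; rewrite /jump_count Tn.
right; rewrite /jump_count Ts'/=.
have nc : (n.+1 <= c)%N by rewrite -(jump_count_le _ Kc); exact: le_trans Ts' _.
(* If jump [n.+1] is the last one up to [K], the next lies beyond [K]; otherwise the gap keeps it
   beyond [s']. *)
move: nc; rewrite leq_eqVlt => /orP[/eqP ->|nc].
  by case/andP: Kc => _; apply: le_lt_trans; rewrite lee_fin.
apply: lt_le_trans (He _ nc).
have [Ti|[tau [Tt _ _]]] := jump_time_fin n.+1.
  by move: Ts'; rewrite Ti leye_eq.
case/andP: sn => _; rewrite Tt -EFinD !lte_fin => stau; lra.
Qed.

(** * Sampling a path along a grid *)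

Definition grid (N l : nat) : R := l%:R / N.+1%:R.

(** For nonnegative [t], the least index of a grid point strictly after [t]. Sampling on the right
    of [t] lets right continuity recover the value at [t]. *)
Definition grid_index (N : nat) (t : R) : nat := (Num.truncn (t * N.+1%:R)).+1.

Definition grid_increment (N l : nat) : nat := (m (grid N l.+1) - m (grid N l))%N.

Lemma gridS N l : grid N l.+1 = grid N l + N.+1%:R^-1.
Proof. by rewrite /grid -natr1 mulrDl mul1r. Qed.

Lemma grid_ge0 N l : 0 <= grid N l. Proof. exact: divr_ge0. Qed.

Lemma grid_le N l l' : (l <= l')%N -> grid N l <= grid N l'.
Proof. by move=> ll; rewrite /grid ler_pM2r ?invr_gt0// ler_nat. Qed.

Lemma grid_index_gt N t : 0 <= t -> t < grid N (grid_index N t).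
Proof.
move=> t0; rewrite /grid /grid_index ltr_pdivlMr//.
by apply: truncnS_gt.
Qed.

Lemma grid_index_le N t : 0 <= t -> grid N (grid_index N t) <= t + N.+1%:R^-1.
Proof.
move=> t0; rewrite gridS lerD2r /grid ler_pdivrMr//.
by rewrite truncn_le ?mulr_ge0.
Qed.

Context (q : nat) (xi : nat -> 'I_q).

(** With at most one jump per cell, the nonzero increments are the jump sizes in order, so counting
    nonzero increments before a cell gives the number of the roll made in it. *)
Lemma grid_jumps N L : (forall l n, (l < L)%N ->
    jump_count (grid N l) n -> jump_count (grid N l.+1) n \/ jump_count (grid N l.+1) n.+1) ->
  exists c, [/\ jump_count (grid N L) c,
    (\sum_(l < L) (grid_increment N l != 0%N))%N = c &
    forall i, (\sum_(l < L) grid_increment N l *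
       (xi (\sum_(l' < l) (grid_increment N l' != 0%N)) == i))%N =
     (\sum_(n < c) jump_size m n.+1 * (xi n == i))%N].
Proof.
elim: L => [|L IH] step.
  exists 0%N; split; rewrite ?big_ord0//; last by move=> i; rewrite !big_ord0.
  rewrite /grid mul0r; apply/andP; split; first exact: lexx.
  by apply: (@jump_time_lt 0); exact: ltry.
have [l n lL|c [Lc cE sE]] := IH; first by apply: step; rewrite ltnS ltnW.
have [Lc'|Lc'] := step _ _ (ltnSn L) Lc.
  have D0 : grid_increment N L = 0%N.
    by rewrite /grid_increment (jump_count_val Lc) (jump_count_val Lc') subnn.
  exists c; split => // [|i]; rewrite big_ord_recr/= D0 ?mul0n addn0//.
have DL : grid_increment N L = jump_size m c.+1.
  by rewrite /grid_increment (jump_count_val Lc) (jump_count_val Lc').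
exists c.+1; split => //.
  by rewrite big_ord_recr/= cE DL -lt0n (jump_size_gt0 Lc') addn1.
by move=> i; rewrite big_ord_recr/= cE DL sE [RHS]big_ord_recr.
Qed.

(** The threshold on [N] depends on the path, but not on [L], so one sample length can serve several
    times at once. *)
Lemma sumn_grid_thin (t : R) (i : 'I_q) : 0 <= t ->
  \forall N \near \oo, forall L, (grid_index N t <= L)%N ->
   sumn (take (grid_index N t)
     (thin (mkseq (grid_increment N) L) (mkseq xi L) i)) =
   \big[addn/0%N]_(n \in [set n | (jump_time m n.+1 <= t%:E)%E])
    (jump_size m n.+1 * (xi n == i))%N.
Proof.
move=> t0; have [c tc] := jump_count_ex t0.
have [e1 e10 He1] : exists2 e : R, 0 < e & (forall s, t <= s -> s < t + e -> jump_count s c).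
  case/andP: (tc) => Tct tTc.
  have [Ti|[tau [Tt _ _]]] := jump_time_fin c.+1.
    exists 1 => // s ts _; rewrite /jump_count Ti ltry andbT.
    by apply: le_trans Tct _; rewrite lee_fin.
  move: tTc; rewrite Tt lte_fin => ttau; exists (tau - t); first by rewrite subr_gt0.
  move=> s ts st; rewrite /jump_count Tt lte_fin; apply/andP; split.
    by apply: le_trans Tct _; rewrite lee_fin.
  by rewrite addrC subrK in st.
(* The grid overshoots [t] by at most one cell, of length at most 1; hence the horizon [t + 1]. *)
have [e2 e20 He2] := jump_count_step (addr_ge0 t0 ler01).
near=> N => L NL.
have h0 : 0 < N.+1%:R^-1 :> R by rewrite invr_gt0.
have he1 : N.+1%:R^-1 < e1.
  by near: N; exact: (near_infty_natSinv_lt (PosNum e10)).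
have he2 : N.+1%:R^-1 < e2.
  by near: N; exact: (near_infty_natSinv_lt (PosNum e20)).
have h1 : N.+1%:R^-1 <= 1 :> R by rewrite invf_le1// ler1n.
have gt := grid_index_gt N t0; have gle := grid_index_le N t0.
have [l n lL|c' [c'E _ sE]] := @grid_jumps N (grid_index N t).
  apply: He2; first exact: grid_le.
    by rewrite (le_trans (grid_le _ lL))// (le_trans gle)// lerD2l.
  by rewrite gridS addrAC subrr add0r.
have cc : c' = c.
  apply: (jump_count_uniq c'E); apply: He1; first exact: ltW.
  by rewrite (le_lt_trans gle)// ltrD2l.
by rewrite sumn_take_thin// sE (fsbig_jumps _ tc) cc.
Unshelve. all: by end_near.
Qed.

End Path.

(** * Independence *)

Lemma sigma_process_rv (T S I : Type) (D : set I) (X : I -> T -> S) t (B : set S) :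
  D t -> sigma_process D X (X t @^-1` B).
Proof.
by move=> Dt; apply: sub_sigma_algebra; exists t => //; exists B => //; rewrite setTI.
Qed.

Section Probability.
Context (d : measure_display) (T : measurableType d) (R : realType).
Variable P : probability T R.

(** [A_ n] lies between the tail intersection [C n] and the tail union [D n], which increase and
    decrease to [A]. *)
Lemma cvg_probability (A_ : nat -> set T) (A : set T) :
  (forall n, measurable (A_ n)) ->
  (forall w, \forall n \near \oo, A_ n w <-> A w) ->
  measurable A /\ P (A_ n) @[n --> \oo] --> P A.
Proof.
move=> mA_ A_A.
pose C n := \bigcap_(k in [set k | (n <= k)%N]) A_ k.
pose D n := \bigcup_(k in [set k | (n <= k)%N]) A_ k.
have mC n : measurable (C n) by exact: bigcap_measurableType.
have mD n : measurable (D n) by exact: bigcup_measurable.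
have CA : \bigcup_n C n = A.
  apply/seteqP; split=> w.
    move=> [n _ Cn]; have [k _ /= kA] := A_A w.
    by apply/(kA (maxn n k)); [exact: leq_maxr|exact/Cn/leq_maxl].
  move=> Aw; have [k _ /= kA] := A_A w; exists k => // j /= kj.
  exact/(kA j).
have DA : \bigcap_n D n = A.
  apply/seteqP; split=> w.
    move=> Dw; have [k _ /= kA] := A_A w; have [j /= kj Aj] := Dw k I.
    exact/(kA j).
  move=> Aw n _; have [k _ /= kA] := A_A w; exists (maxn n k).
    exact: leq_maxl.
  by apply/(kA (maxn n k)); [exact: leq_maxr|].
have mA : measurable A by rewrite -CA; exact: bigcup_measurable.
split => //; apply: (@squeeze_cvge _ _ _ _ (P \o C) _ (P \o D)).
- apply: nearW => n /=; apply/andP; split; apply: le_measure; rewrite ?inE//.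
    by apply: bigcap_inf => /=.
  by apply: bigcup_sup => /=.
- rewrite -CA; apply: nondecreasing_cvg_mu; rewrite ?CA//.
  move=> n k nk; apply/subsetPset => w Cw j /= kj.
  by apply: Cw => /=; exact: leq_trans kj.
- rewrite -DA; apply: nonincreasing_cvg_mu; rewrite ?DA//.
    by rewrite (le_lt_trans (probability_le1 P (mD 0%N)))// ltry.
  move=> n k nk; apply/subsetPset => w [j /= kj Aj].
  by exists j => //=; exact: leq_trans kj.
Qed.

Lemma mutual_independence_seq (I : choiceType) (F : I -> set (set T))
    (s : seq I) (E : I -> set T) : mutual_independence P F -> uniq s ->
  (forall i, i \in s -> F i (E i)) ->
  P (\bigcap_(i in [set` s]) E i) = (\prod_(i <- s) P (E i))%E.
Proof.
move=> [_ indF] us FE.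
have := indF [fset x in s]%fset E.
rewrite (_ : [set` [fset x in s]%fset] = [set` s]); last first.
  by apply/seteqP; split=> x /=; rewrite inE.
move=> ->; last by move=> j; rewrite inE; exact: FE.
apply: perm_big; apply: uniq_perm; [exact: fset_uniq|exact: us|].
by move=> x; rewrite inE.
Qed.

Lemma sub_mutual_independence (I : choiceType) (F F' : I -> set (set T)) :
  (forall i, F i `<=` F' i) -> mutual_independence P F' ->
  mutual_independence P F.
Proof.
move=> FF' [mF' indF']; split; first by move=> i A /FF'/mF'.
by move=> J E FE; apply: indF' => j /FE /FF'.
Qed.

Lemma dynkin_independent (C : set T) : measurable C ->
  dynkin [set A | measurable A /\ P (A `&` C) = (P A * P C)%E].
Proof.
move=> mC; split => /=.
- by rewrite setTI probability_setT mul1e.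
- move=> A [mA PA]; split; first exact: measurableC.
  have PCoo : (P C < +oo)%E by rewrite (le_lt_trans (probability_le1 P mC))// ltry.
  rewrite setIC -setDE measureD//.
  rewrite (setIC C A); transitivity (P C - P A * P C)%E; first by rewrite -PA.
  rewrite probability_setC// muleBl ?mul1e// ?fin_num_measure//.
- move=> F tF FP; split; first by apply: bigcup_measurable => k _; case: (FP k).
  rewrite setI_bigcupl !measure_bigcup//=.
  + rewrite muleC -[P C]fineK ?fin_num_measure// -nneseriesZl//.
    by apply: eq_eseriesr => n _; rewrite fineK ?fin_num_measure// muleC; case: (FP n).
  + by move=> n _; case: (FP n).
  + by move=> n _; apply: measurableI => //; case: (FP n).
  + exact: trivIset_setIr.
Qed.

(** The indices are upgraded one by one from [G i] to its generated sigma-algebra: with the other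
    events fixed, the sets obeying the product rule form a Dynkin system containing the pi-system
    [G i]. *)
Lemma mutual_independence_pi (I : finType) (G : I -> set (set T)) :
  (forall i, setI_closed (G i)) -> (forall i, G i setT) ->
  (forall i, G i `<=` measurable) ->
  (forall E : I -> set T, (forall i, G i (E i)) ->
    P (\bigcap_i E i) = (\prod_i P (E i))%E) ->
  mutual_independence P (fun i => <<s G i>>).
Proof.
move=> GI GT mG indG.
have msG i : <<s G i>> `<=` measurable.
  apply: smallest_sub => //; exact: sigma_algebra_measurable.
(* [s] lists the indices already upgraded. *)
have key (s : seq I) : forall E : I -> set T,
    (forall i, if i \in s then <<s G i>> (E i) else G i (E i)) ->
    P (\bigcap_i E i) = (\prod_i P (E i))%E.
  elim: s => [|i s IH] E GE; first by apply: indG => i; exact: (GE i).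
  have [si|si] := boolP (i \in s).
    apply: IH => j; have := GE j; rewrite in_cons.
    by case: eqP => [->|//]; rewrite si.
  pose C := \bigcap_(j in [set j | j != i]) E j.
  have mE j : measurable (E j).
    have := GE j; case: ifP => _ h; [exact: (msG j)|exact: (mG j)].
  have mC : measurable C.
    by apply: fin_bigcap_measurable => //; exact: finite_finset.
  have AC A : \bigcap_j (if j == i then A else E j) = A `&` C.
    apply/seteqP; split=> w.
      move=> h; split; first by have := h i Logic.I; rewrite eqxx.
      by move=> j /= /negbTE ji; have := h j Logic.I; rewrite ji.
    by move=> [Aw Cw] j _; case: ifPn => // /Cw.
  have PAC A : G i A -> P (A `&` C) = (P A * \prod_(j | j != i) P (E j))%E.
    move=> GA; rewrite -AC IH.
      rewrite (bigD1 i)//= eqxx; congr *%E.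
      by apply: eq_bigr => j /negbTE ->.
    move=> j; case: (eqVneq j i) => [->|ji]; first by rewrite (negbTE si).
    by have := GE j; rewrite in_cons (negbTE ji).
  have PC : P C = (\prod_(j | j != i) P (E j))%E.
    by have := PAC _ (GT i); rewrite setTI probability_setT mul1e.
  have sub : <<s G i>> `<=` [set A | measurable A /\ P (A `&` C) = (P A * P C)%E].
    rewrite -setI_closed_g_dynkin_g_sigma_algebra//; apply: smallest_sub.
      exact: dynkin_independent.
    by move=> A GA; split; [exact: (mG i)|rewrite PC; exact: PAC].
  have := GE i; rewrite mem_head => /sub[_]; rewrite PC -AC => e.
  rewrite (bigD1 i)//= -e; congr (P _); apply: eq_bigcap => // j _.
  by case: eqP => [->|].
split => // J E GE.
(* A subfamily is padded with the full space, which has probability one. *)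
have := key (index_enum I) (fun i => if i \in J then E i else setT).
rewrite (_ : \bigcap_i _ = \bigcap_(j in [set` J]) E j); last first.
  apply/seteqP; split=> w h j /=.
    by move=> jJ; have := h j Logic.I; rewrite jJ.
  by move=> _; case: ifPn => // /h.
move=> ->.
  rewrite (bigID (mem J))/= [X in (_ * X)%E]big1 ?mule1; last first.
    by move=> j /negbTE ->; rewrite probability_setT.
  rewrite (eq_bigr (fun j => P (E j))); last by move=> j ->.
  rewrite -big_filter; apply: perm_big; apply: uniq_perm.
  - by rewrite filter_uniq// index_enum_uniq.
  - exact: fset_uniq.
  - by move=> j; rewrite mem_filter mem_index_enum andbT.
move=> j; rewrite mem_index_enum; case: ifPn => [/GE//|_].
exact: sub_sigma_algebra.
Qed.

(** Each pair is an index with a prescribed value. For [nat]-valued processes single values suffice,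
    every set of values being a countable union of singletons; lists make closure under intersection
    a concatenation. *)
Definition cylinders (S : eqType) (I : eqType) (D : set I) (X : I -> T -> S) :
    set (set T) :=
  [set A | exists2 s : seq (I * S), (forall x, x \in s -> D x.1) &
    A = [set w | all (fun x => X x.1 w == x.2) s]].

Lemma setI_closed_cylinders (S I : eqType) (D : set I) (X : I -> T -> S) :
  setI_closed (cylinders D X).
Proof.
move=> A B [s sD ->] [s' s'D ->]; exists (s ++ s').
  by move=> x; rewrite mem_cat => /orP[/sD|/s'D].
by apply/seteqP; split=> w /=; rewrite all_cat => /andP.
Qed.

Lemma cylindersT (S I : eqType) (D : set I) (X : I -> T -> S) :
  cylinders D X setT.
Proof. by exists [::] => //; apply/seteqP; split. Qed.

Lemma sub_sigma_process_cylinders (I : eqType) (D : set I) (X : I -> T -> nat) :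
  sigma_process D X `<=` <<s cylinders D X >>.
Proof.
apply: smallest_sub; first exact: smallest_sigma_algebra.
move=> A [t Dt [B _ <-]]; rewrite setTI.
rewrite (_ : _ @^-1` _ = \bigcup_(b in B) [set w | all (fun x => X x.1 w == x.2) [:: (t, b)]]).
  rewrite bigcup_mkcond; have [sG0 _ sGU] := smallest_sigma_algebra setT (cylinders D X).
  apply: sGU => b; case: ifPn => _; last exact: sG0.
  apply: sub_sigma_algebra; exists [:: (t, b)] => //.
  by move=> x; rewrite inE => /eqP ->.
apply/seteqP; split=> w /=; first by move=> BX; exists (X t w) => //=; rewrite eqxx.
by move=> [b Bb] /=; rewrite andbT => /eqP ->.
Qed.

Lemma probability_fin_partition (F : finType) (Z : T -> F) (B : pred F) :
  (forall z, measurable (Z @^-1` [set z])) ->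
  measurable [set w | B (Z w)] /\
  fine (P [set w | B (Z w)]) = \sum_(z | B z) fine (P (Z @^-1` [set z])).
Proof.
move=> mZ; pose r := [seq z <- index_enum F | B z].
have BE : [set w | B (Z w)] = \bigcup_(z in [set` r]) Z @^-1` [set z].
  apply/seteqP; split=> w /=.
    by move=> BZ; exists (Z w) => //=; rewrite mem_filter BZ mem_index_enum.
  by move=> [z /=]; rewrite mem_filter => /andP[Bz _] ->.
have mB : measurable [set w | B (Z w)].
  by rewrite BE; apply: fin_bigcup_measurable => //; exact: finite_seq.
split => //; rewrite BE measure_fin_bigcup; last by move=> z _; exact: mZ.
- rewrite -fsbig_seq ?filter_uniq ?index_enum_uniq// big_filter -sum_fine//.
  by move=> z _; rewrite fin_num_measure.
- exact: finite_seq.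
- by move=> z z' _ _ [w [/= <- <-]].
Qed.

End Probability.

(** * The discretized process *)

Section Law.
Context (d : measure_display) (T : measurableType d) (R : realType).
Context (P : probability T R) (k : nat) (lambda : nat -> R).
Context (M : R -> {RV P >-> nat}) (q : nat) (p : 'I_q -> R).
Context (xi : nat -> T -> 'I_q).
Hypothesis hM : generalized_counting_process k lambda M.
Hypothesis hxi : die_rolls p M xi.
Context (m N : nat).

Definition capped_increment (l : nat) (w : T) : 'I_m.+1 :=
  inord (minn (grid_increment (M ^~ w) N l) m).

Definition capped_law (v : 'I_m.+1) : R :=
  fine (P (capped_increment 0 @^-1` [set v])).

Lemma capped_incrementE l w :
  capped_increment l w = minn (grid_increment (M ^~ w) N l) m :> nat.
Proof. by rewrite inordK// ltnS geq_minr. Qed.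

Lemma capped_increment_rv l (v : 'I_m.+1) :
  sigma_rv (increment M (grid R N l) (grid R N l.+1)) (capped_increment l @^-1` [set v]).
Proof. by exists [set n | inord (minn n m) = v] => //; rewrite setTI. Qed.

Lemma grid_increments_independent L : mutual_independence P
  (fun l : 'I_L => sigma_rv (increment M (grid R N l) (grid R N l.+1))).
Proof.
apply: (gcp_independent_increments hM) => [|l _]; first exact: grid_ge0.
exact: grid_le.
Qed.

Lemma measurable_capped_increment l (v : 'I_m.+1) :
  measurable (capped_increment l @^-1` [set v]).
Proof.
have [mG _] := grid_increments_independent l.+1.
exact: (mG ord_max _ (capped_increment_rv l v)).
Qed.

Lemma capped_lawE l (v : 'I_m.+1) :
  P (capped_increment l @^-1` [set v]) = (capped_law v)%:E.
Proof.
rewrite /capped_law fineK ?fin_num_measure//; last exact: measurable_capped_increment.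
have /= := @gcp_stationary_increments _ _ _ _ _ _ _ hM (grid R N l) (grid R N 0) N.+1%:R^-1
  [set n | inord (minn n m) = v] (grid_ge0 R N l) (grid_ge0 R N 0).
rewrite -!gridS; apply.
by rewrite invr_ge0.
Qed.

Lemma capped_law_ge0 v : 0 <= capped_law v.
Proof. by rewrite fine_ge0. Qed.

Lemma sum_capped_law : \sum_v capped_law v = 1.
Proof.
have [_] := probability_fin_partition P predT (measurable_capped_increment 0).
move=> <-; rewrite (_ : [set w | _] = setT) ?probability_setT//.
by apply/seteqP; split.
Qed.

(** Needed to apply the independence of the rolls from [M]; an increment involves two times, so the
    event is split over the values at the left end of the cell. *)
Lemma capped_increment_process l (v : 'I_m.+1) :
  sigma_process (@times R) M (capped_increment l @^-1` [set v]).
Proof.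
rewrite (_ : _ @^-1` _ = \bigcup_b (M (grid R N l) @^-1` [set b] `&`
    M (grid R N l.+1) @^-1` [set a | inord (minn (a - b) m) = v])); last first.
  by apply/seteqP; split=> w /= => [wv|[b _ [<- //]]]; exists (M (grid R N l) w).
apply: (@bigcup_measurable _ (g_sigma_algebraType _)) => b _.
apply: (@measurableI _ (g_sigma_algebraType _)).
  by apply: (@sigma_process_rv _ _ _ _ M); exact: grid_ge0.
by apply: (@sigma_process_rv _ _ _ _ M); exact: grid_ge0.
Qed.

Definition grid_sample L (w : T) : L.-tuple 'I_m.+1 * L.-tuple 'I_q :=
  ([tuple capped_increment l w | l < L], [tuple xi l w | l < L]).

Let capped_event L (s : L.-tuple 'I_m.+1) :=
  \bigcap_(l in [set` index_enum 'I_L]) capped_increment l @^-1` [set tnth s l].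

(* [nth i e l = i] expresses that the [l]-th entry of [e] is [i] without a
   default element of ['I_q]. *)
Let roll_event L (e : L.-tuple 'I_q) :=
  \bigcap_(l in [set` iota 0 L]) xi l @^-1` [set i | nth i e l = i].

Lemma grid_sampleE L s e :
  @grid_sample L @^-1` [set (s, e)] = roll_event e `&` capped_event s.
Proof.
apply/seteqP; split=> w /=.
  move=> [<- <-]; split=> l /=.
    rewrite mem_iota add0n => lL.
    have := tnth_nth (xi l w) [tuple xi l w | l < L] (Ordinal lL).
    by rewrite tnth_mktuple => /esym.
  by move=> _; rewrite tnth_mktuple.
move=> [we ws]; congr pair; apply: eq_from_tnth => l; rewrite tnth_mktuple.
  by apply: ws; exact: mem_index_enum.
have /= := we l; rewrite mem_iota add0n => /(_ (ltn_ord l)).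
by rewrite (tnth_nth (xi l w)).
Qed.

(** Three independences combine: of the rolls from the process, of the rolls among themselves, and
    of the increments, whose common law comes from stationarity. *)
Lemma grid_sample_law L s e : P (@grid_sample L @^-1` [set (s, e)]) =
  ((\prod_(v <- s) capped_law v) * (\prod_(i <- e) p i))%:E.
Proof.
have rollsP : sigma_process [set: nat] xi (roll_event e).
  apply: (@fin_bigcap_measurable _ (g_sigma_algebraType _)); first exact: finite_seq.
  by move=> l _; exact: sigma_process_rv.
have incP : sigma_process (@times R) M (capped_event s).
  apply: (@fin_bigcap_measurable _ (g_sigma_algebraType _)); first exact: finite_seq.
  by move=> l _; exact: capped_increment_process.
rewrite grid_sampleE (rolls_independent_of_process hxi rollsP incP).
rewrite (mutual_independence_seq (rolls_independent hxi)) ?iota_uniq//; last first.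
  by move=> l _; eexists; [|rewrite setTI].
rewrite (mutual_independence_seq (grid_increments_independent L)) ?index_enum_uniq//; last first.
  by move=> l _; exact: capped_increment_rv.
rewrite muleC EFinM; congr *%E.
  rewrite (eq_bigr _ (fun (l : 'I_L) _ => capped_lawE l (tnth s l))) prodEFin.
  by rewrite big_tuple.
rewrite (_ : iota 0 L = index_iota 0 L) ?big_mkord; last by rewrite /index_iota subn0.
rewrite (eq_bigr (fun l : 'I_L => (p (tnth e l))%:E)).
  by rewrite prodEFin big_tuple.
move=> l _; rewrite -(rolls_law hxi l); congr (P _); apply/seteqP; split=> w /=.
  by rewrite -tnth_nth => <-.
by move=> xl; rewrite -tnth_nth xl.
Qed.

Lemma measurable_grid_sample L z : measurable (@grid_sample L @^-1` [set z]).
Proof.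
case: z => s e; rewrite grid_sampleE; apply: measurableI.
  apply: fin_bigcap_measurable; first exact: finite_seq.
  move=> l _; have [mG _] := rolls_independent hxi.
  by apply: (mG l); eexists; [|rewrite setTI].
apply: fin_bigcap_measurable; first exact: finite_seq.
by move=> l _; exact: measurable_capped_increment.
Qed.

Hypothesis sum_p : \sum_i p i = 1.

Definition grid_thin L (w : T) : 'I_q -> seq nat :=
  thin (mkseq (fun l => capped_increment l w : nat) L) (mkseq (xi ^~ w) L).

(** The event depends on the finite-valued [grid_sample] only, so its probability is a finite sum of
    product weights, to which [thin_mean] applies. *)
Lemma grid_thin_law L (B : pred ('I_q -> seq nat)) :
  measurable [set w | B (grid_thin L w)] /\
  fine (P [set w | B (grid_thin L w)]) =
  cells_mean capped_law p L (fun X => (B X)%:R).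
Proof.
have mkE (A : Type) (f : nat -> A) : mkseq f L = [tuple f l | l < L].
  by rewrite /= /mkseq -val_enum_ord -map_comp enumT.
have thinE w : grid_thin L w = thin (map (@nat_of_ord m.+1) (@grid_sample L w).1) (@grid_sample L w).2.
  by rewrite /grid_thin !mkE /= -map_comp.
have := probability_fin_partition P (fun z : L.-tuple 'I_m.+1 * L.-tuple 'I_q =>
  B (thin (map (@nat_of_ord m.+1) z.1) z.2)) (@measurable_grid_sample L).
under eq_set do rewrite -thinE; move=> [mB ->]; split => //.
rewrite -(thin_mean capped_law sum_p _ (leqnn L)) pair_bigA/= big_mkcond/=.
apply: eq_bigr => -[s e] _ /=; rewrite grid_sample_law/=.
by case: (B _); rewrite ?mulr1 ?mulr0.
Qed.

End Law.

Arguments capped_law {d T R P} M m N v.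
Arguments grid_thin {d T R P} M {q} xi m N L w _.

(** * Passage to the limit of vanishing cells *)

Lemma near_seq (T : eqType) (U : Type) (F : set_system U) (s : seq T)
    (Q : T -> U -> Prop) : Filter F ->
  (forall x, x \in s -> \forall n \near F, Q x n) ->
  \forall n \near F, forall x, x \in s -> Q x n.
Proof.
move=> FF; elim: s => [|x s IH] sQ; first by apply: filterE.
have h1 := sQ x (mem_head _ _).
have h2 : \forall n \near F, forall y, y \in s -> Q y n.
  by apply: IH => y ys; apply: sQ; rewrite in_cons ys orbT.
apply: filterS2 h1 h2 => n Qx Qs y.
by rewrite in_cons => /orP[/eqP->//|]; exact: Qs.
Qed.

(** An entry above [b] spoils both equalities, even after capping; entries up to [b] are below the
    cap and unchanged. *)
Lemma sumn_capped (m b : nat) (s : seq nat) : (b < m)%N ->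
  (sumn (map (minn^~ m) s) == b) = (sumn s == b).
Proof.
elim: s b => [//|a s IH] b bm /=.
have [ab|ab] := leqP a b; last by apply/idP/idP; lia.
have := IH (b - a)%N (leq_ltn_trans (leq_subr _ _) bm).
rewrite (minn_idPl _); last by rewrite ltnW// (leq_ltn_trans ab).
by move=> e; rewrite -(eqn_add2l a) subnKC// in e; rewrite e -(eqn_add2l a) subnKC.
Qed.

Section Limit.
Context (d : measure_display) (T : measurableType d) (R : realType).
Context (P : probability T R) (k : nat) (lambda : nat -> R).
Context (M : R -> {RV P >-> nat}) (q : nat) (p : 'I_q -> R).
Context (xi : nat -> T -> 'I_q).
Hypothesis hM : generalized_counting_process k lambda M.
Hypothesis hxi : die_rolls p M xi.
Hypothesis p_ge0 : forall i, 0 <= p i.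
Hypothesis sum_p : \sum_i p i = 1.

(** This is the estimate a = O(h). Since [m] is positive, the capped increment vanishes only if the
    increment does, so [gcp_no_jump] at time 0 applies. *)
Lemma capped_law0_rate m : (0 < m)%N -> exists2 C : R, 0 <= C &
  \forall N \near \oo, 1 - capped_law M m N ord0 <= C * N.+1%:R^-1.
Proof.
move=> m0; have M0 : M 0 @^-1` [set 0%N] = setT.
  by apply/seteqP; split=> // w _ /=; rewrite (gcp_start hM).
have P0 : P (M 0 @^-1` [set 0%N]) != 0%E by rewrite M0 probability_setT oner_neq0.
(* The o(h) term is eventually at most h, which accounts for the [+ 1] in the constant below; the
   absolute value there keeps it nonnegative. *)
have /eqoP/(_ 1 ltr01) := gcp_no_jump hM (lexx 0) P0.
move=> -[e /= e0 He].
exists (`|\sum_(1 <= i < k.+1) lambda i| + 1); first by rewrite addr_ge0.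
near=> N.
have h0 : 0 < N.+1%:R^-1 :> R by rewrite invr_gt0.
have he : N.+1%:R^-1 < e by near: N; exact: (near_infty_natSinv_lt (PosNum e0)).
have := He N.+1%:R^-1; rewrite /ball_/= sub0r normrN gtr0_norm// => /(_ he h0).
rewrite M0 /cond_prob setIT probability_setT divr1 mul1r add0r.
rewrite (_ : fine _ = capped_law M m N ord0); last first.
  rewrite /capped_law; congr (fine (P _)); apply/seteqP; split=> w.
    move=> Mw; apply: ord_inj; rewrite capped_incrementE /grid_increment.
    by rewrite /grid mul1r mul0r Mw sub0n min0n.
  move=> /(congr1 (@nat_of_ord _)); rewrite capped_incrementE /grid_increment.
  rewrite /grid mul1r mul0r (gcp_start hM) subn0/=.
  by move=> cap0; apply/eqP; move: cap0 m0; case: (M _ w) => [|n] /=; lia.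
rewrite ler_norml => /andP[+ _]; set S := \sum_(_ <= _ < _) _.
have := ler_wpM2r (ltW h0) (ler_norm S). rewrite mulrDl mul1r.
move: (_^-1) (`|S| / _) (S / _) => a b c; lra.
Unshelve. all: by end_near.
Qed.

Let sc := split_component M xi.

(** Measurability is obtained together with the product rule, since each [E i] arises as a pointwise
    limit of discretized events. *)
Lemma indep_cylinders (E : 'I_q -> set T) :
  (forall i, cylinders (@times R) (sc i) (E i)) ->
  (forall i, measurable (E i)) /\
  P (\bigcap_i E i) = (\prod_i P (E i))%E.
Proof.
move=> cylE; have [s] : {s : 'I_q -> seq (R * nat) & forall i,
    (forall x, x \in s i -> times x.1) /\
    E i = [set w | all (fun x => sc i x.1 w == x.2) (s i)]}.
  apply: (@choice _ _ (fun i (s : seq (R * nat)) =>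
    (forall x, x \in s -> times x.1) /\
    E i = [set w | all (fun x => sc i x.1 w == x.2) s])) => i; have [t tD tE] := cylE i; by exists t.
move=> sDE; have [sD sE] := all_and2 sDE.
pose l := flatten [seq s i | i <- enum 'I_q].
have sl i x : x \in s i -> x \in l.
  by move=> xs; apply/flattenP; exists (s i) => //; apply: map_f; rewrite mem_enum.
(* [K] bounds all times occurring in the cylinders, and [m] below exceeds all prescribed values, so
   capping does not affect the events. *)
pose K : R := \sum_(x <- l) `|x.1|.
have K0 : 0 <= K by exact: sumr_ge0.
have xK i x : x \in s i -> x.1 <= K.
  move=> /sl xl; rewrite /K (big_rem x)//= (le_trans (ler_norm _))// lerDl.
  exact: sumr_ge0.
pose m := (\sum_(x <- l) x.2).+1.
have xm i x : x \in s i -> (x.2 < m)%N.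
  by move=> /sl xl; rewrite /m ltnS (big_rem x)//= leq_addr.
pose L N := grid_index N K.
pose B N i : pred (seq nat) := fun y =>
  all (fun x : R * nat => sumn (take (grid_index N x.1) y) == x.2) (s i).
pose A i N := [set w | B N i (grid_thin M xi m N (L N) w i)].
have AE i w : \forall N \near \oo, A i N w <-> E i w.
  have [nd rc] := gcp_counting hM.
  have : \forall N \near \oo, forall x, x \in s i ->
      (sumn (take (grid_index N x.1) (grid_thin M xi m N (L N) w i)) == x.2) =
      (sc i x.1 w == x.2).
    apply: near_seq => x xs; have x0 := sD _ _ xs.
    have := sumn_grid_thin (nd w) (rc w) (xi ^~ w) i x0.
    apply: filterS => N /(_ (L N)) h.
    have xL : (grid_index N x.1 <= L N)%N.
      by rewrite ltnS le_truncn// ler_pM2r// (xK i).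
    rewrite /grid_thin (_ : mkseq _ _ =
      map (minn^~ m) (mkseq (grid_increment (M ^~ w) N) (L N))); last first.
      by rewrite -map_comp; apply: eq_map => j; rewrite capped_incrementE.
    rewrite map_thin; last by move=> n; rewrite /m; lia.
    rewrite -map_take sumn_capped ?(xm i)//.
    by rewrite h.
  apply: filterS => N h; rewrite /A (sE i)/= /B.
  by rewrite (eq_in_all h).
have Blaw N j := grid_thin_law hM hxi m N sum_p (L N)
  (fun X => B N j (X j)).
have mA i N : measurable (A i N) by case: (Blaw N i).
have cvgA i := cvg_probability P (mA i) (AE i).
have mE i : measurable (E i) by case: (cvgA i).
split => //.
pose BI N : pred ('I_q -> seq nat) := fun X => [forall j, B N j (X j)].
have BIlaw N := grid_thin_law hM hxi m N sum_p (L N) (BI N).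
have [||mI cvgI] := @cvg_probability _ _ _ P
    (fun N => [set w | BI N (grid_thin M xi m N (L N) w)]) (\bigcap_i E i).
- by move=> N; case: (BIlaw N).
- move=> w.
  have : \forall N \near \oo, forall i, i \in enum 'I_q -> (A i N w <-> E i w).
    by apply: near_seq => i _; exact: AE.
  apply: filterS => N h; split=> /=.
    by move=> /forallP Bw i _; apply/h; [rewrite mem_enum|exact: Bw].
  by move=> Ew; apply/forallP => i; apply/(h i); [rewrite mem_enum|exact: Ew].
(* [u] is the joint probability and [v] the product of the marginal ones, both after
   discretization. *)
pose u N := fine (P [set w | BI N (grid_thin M xi m N (L N) w)]).
pose v N := \prod_i fine (P (A i N)).
have cvgu : u N @[N --> \oo] --> fine (P (\bigcap_i E i)).
  by apply: fine_cvg; rewrite fineK// fin_num_measure.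
have cvgv : v N @[N --> \oo] --> \prod_i fine (P (E i)).
  apply: cvg_big; first exact: mul_continuous.
  move=> i _; apply: fine_cvg; rewrite fineK ?fin_num_measure//.
  by case: (cvgA i).
have [C C0 rate] := capped_law0_rate (m := m) isT.
(* About (K + 1) / h cells, each with error at most (C h)^2, where h = 1 / (N + 1). *)
have uv : \forall N \near \oo, `|u N - v N| <= (K + 1) * C ^+ 2 * N.+1%:R^-1.
  apply: filterS rate => N rate.
  have [_ uE] := BIlaw N.
  have -> : u N = cells_mean (capped_law M m N) p (L N)
      (fun X => \prod_j (B N j (X j))%:R).
    rewrite /u uE; congr cells_mean; apply/funext => X; rewrite /BI.
    case: forallP => BX; first by rewrite big1// => j _; rewrite BX.
    have [j nB] : exists j, ~~ B N j (X j).
      by apply/existsP; rewrite -negb_forall; apply/forallP.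
    by rewrite (bigD1 j)//= (negbTE nB) mul0r.
  have -> : v N = \prod_j cells_mean (capped_law M m N) p (L N)
      (fun X => (B N j (X j))%:R).
    by apply: eq_bigr => j _; case: (Blaw N j).
  have r0 : 0 <= 1 - capped_law M m N ord0.
    rewrite subr_ge0 -(sum_capped_law hM m N) (bigD1 ord0)//= lerDl.
    by apply: sumr_ge0 => j _; exact: capped_law_ge0.
  have B01 j y : 0 <= ((B N j y)%:R : R) <= 1.
    by case: (B N j y); rewrite ?ler01 ?lexx.
  apply: le_trans (cells_mean_prod (capped_law_ge0 M N) p_ge0
    (sum_capped_law hM m N) sum_p (L N) B01) _.
  have N0 : 0 < N.+1%:R :> R by [].
  have LK : (L N)%:R <= (K + 1) * N.+1%:R.
    have := grid_index_le N K0; rewrite -/(L N) /grid ler_pdivrMr// => /le_trans; apply.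
    by rewrite ler_pM2r// lerD2l invf_le1// ler1n.
  have -> : (K + 1) * C ^+ 2 * N.+1%:R^-1 = (K + 1) * N.+1%:R * (C * N.+1%:R^-1) ^+ 2.
    by field.
  by apply: ler_pM => //; [exact: exprn_ge0|rewrite lerXn2r// nnegrE (le_trans r0)].
have cvgu' : u N @[N --> \oo] --> \prod_i fine (P (E i)).
  pose c := (K + 1) * C ^+ 2.
  have c0 : (fun N : nat => c * N.+1%:R^-1) @ \oo --> (0 : R).
    by rewrite -[X in _ --> X](mulr0 c); apply: cvgMr; exact: cvg_harmonic.
  apply: (@squeeze_cvgr _ _ _ _ (fun N => v N - c * N.+1%:R^-1) (fun N => v N + c * N.+1%:R^-1)).
  - by apply: filterS uv => N; rewrite ler_distl.
  - by rewrite -[X in _ --> X]subr0; apply: cvgB.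
  - by rewrite -[X in _ --> X]addr0; apply: cvgD.
have uvE : fine (P (\bigcap_i E i)) = \prod_i fine (P (E i)).
  exact: (cvg_unique _ cvgu cvgu').
rewrite -[LHS]fineK ?fin_num_measure// uvE -prodEFin.
by apply: eq_bigr => i _; rewrite fineK// fin_num_measure.
Qed.

End Limit.

Unset Implicit Arguments.

Theorem proposition5p4 (d : measure_display) (T : measurableType d)
    (R : realType) (P : probability T R)
    (k : nat) (lambda : nat -> R) (M : R -> {RV P >-> nat})
    (q : nat) (p : 'I_q -> R) (xi : nat -> T -> 'I_q)
    (hk : (1 <= k)%N)
    (hlambda : forall j, (1 <= j <= k)%N -> 0 < lambda j)
    (hM : generalized_counting_process k lambda M)
    (hq : (2 <= q)%N)
    (hp0 : forall i, 0 <= p i)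
    (hp1 : \sum_(i < q) p i = 1)
    (hxi : die_rolls p M xi) :
  mutual_independence P
    (fun i : 'I_q => sigma_process (@times R) (split_component M xi i)).
Proof.
have cyl (E : 'I_q -> set T) := indep_cylinders hM hxi hp0 hp1 (E := E).
apply: (@sub_mutual_independence _ _ _ _ _ _
  (fun i => <<s cylinders (@times R) (split_component M xi i) >>)).
  by move=> i; exact: sub_sigma_process_cylinders.
apply: mutual_independence_pi.
- by move=> i; exact: setI_closed_cylinders.
- by move=> i; exact: cylindersT.
- move=> i A Ai; have [|mE _] := cyl (fun j => if j == i then A else setT).
    by move=> j; case: eqP => [->//|_]; exact: cylindersT.
  by have := mE i; rewrite eqxx.
- by move=> E EG; have [] := cyl E EG.
Qed.
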